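(* Let $A\in\mathbb{R}^{n\times n}$, $B\in\mathbb{R}^{n\times m}$, and consider the linear system $x(k+1)=f(x(k),u(k))$ with $f(x,u)=Ax+Bu$ and constraint set $\mathbb{Y}\subseteq\mathbb{R}^n\times\mathbb{R}^m$. Consider quadratic stage costs $$\ell_i(x,u)=x^TQ_ix+u^TR_iu+s_i^Tx+v_i^Tu,\qquad i=1,2,$$ where $Q_i\in\mathbb{R}^{n\times n}$ is symmetric and positive semidefinite, $R_i\in\mathbb{R}^{m\times m}$ is symmetric and positive definite, $s_i\in\mathbb{R}^n$ and $v_i\in\mathbb{R}^m$. Assume that $\mathbb{Y}$ is either convex and compact or $\mathbb{Y}=\mathbb{R}^n\times\mathbb{R}^m$, and that the system is strictly dissipative for both $\ell_1$ and $\ell_2$. For $\mu\in[0,1]$ let $\ell_\mu:=\mu\ell_1+(1-\mu)\ell_2$ and let $(x_\mu^e,u_\mu^e)$ denote the globally optimal equilibrium for $\ell_\mu$, i.e. the minimiser of $\ell_\mu(x,u)$ over all $(x,u)\in\mathbb{Y}$ with $x=f(x,u)$. In case $\mathbb{Y}$ is compact, assume that $(x_\mu^e,u_\mu^e)\in\operatorname{int}\mathbb{Y}$ for all $\mu\in[0,1]$. Then the system is strictly dissipative at $(x_\mu^e,u_\mu^e)$ for the cost function $\ell_\mu$ for all $\mu\in[0,1]$.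
   Context: Let $f:\mathbb{R}^n\times\mathbb{R}^m\to\mathbb{R}^n$ be continuous, let $\mathbb{Y}\subseteq\mathbb{R}^n\times\mathbb{R}^m$ be a non-empty combined state and input constraint set, and let $\mathbb{X}:=\{x\in\mathbb{R}^n : \text{there is } u\in\mathbb{R}^m \text{ with } (x,u)\in\mathbb{Y}\}$. The system is $x(k+1)=f(x(k),u(k))$. A stage cost (cost function) is a function $\ell:\mathbb{Y}\to\mathbb{R}$. An equilibrium is a pair $(x^e,u^e)\in\mathbb{Y}$ with $x^e=f(x^e,u^e)$. $\|\cdot\|$ is an arbitrary norm on $\mathbb{R}^n$. $\mathcal{K}_\infty$ is the set of continuous, strictly increasing, unbounded functions $\alpha:[0,\infty)\to[0,\infty)$ with $\alpha(0)=0$. The system is strictly pre-dissipative for the stage cost $\ell$ at an equilibrium $(x^e,u^e)$ if there exist a storage function $\lambda:\mathbb{X}\to\mathbb{R}$, bounded on bounded subsets of $\mathbb{X}$, and $\alpha\in\mathcal{K}_\infty$ such that for all $(x,u)\in\mathbb{Y}$ with $f(x,u)\in\mathbb{X}$ $$\ell(x,u)-\ell(x^e,u^e)+\lambda(x)-\lambda(f(x,u))\ge\alpha(\|x-x^e\|).$$ It is strictly dissipative for $\ell$ at $(x^e,u^e)$ if in addition $\lambda$ is bounded from below on $\mathbb{X}$. If no equilibrium is named, the property is meant at some equilibrium. *)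

(* Defs.v *)
From HB Require Import structures.
From mathcomp Require Import all_boot all_order all_algebra.
From mathcomp Require Import all_classical all_reals all_analysis.

Set Implicit Arguments.
Unset Strict Implicit.
Unset Printing Implicit Defensive.

Import Order.TTheory GRing.Theory Num.Theory.
Import numFieldNormedType.Exports.

Local Open Scope classical_set_scope.
Local Open Scope ring_scope.

(* An arbitrary norm on R^n, not the canonical sup norm of matrices.
   Nonnegativity and nrm 0 = 0 follow from these axioms. *)
Record is_norm (R : realType) (n : nat) (nrm : 'cV[R]_n -> R) : Prop := IsNorm {
  norm_triangle : forall x y, nrm (x + y) <= nrm x + nrm y ;
  norm_scale : forall (a : R) x, nrm (a *: x) = `|a| * nrm x ;
  norm_definite : forall x, nrm x = 0 -> x = 0 }.

(* Functions [0, oo) -> [0, oo) are total functions R -> R whose values on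
   negative numbers are irrelevant. *)
Definition class_Kinf (R : realType) (alpha : R -> R) : Prop :=
  [/\ {within `[0, +oo[, continuous alpha},
      forall r, 0 <= r -> 0 <= alpha r,
      forall r t, 0 <= r -> r < t -> alpha r < alpha t,
      forall M, exists2 r, 0 <= r & M < alpha r
    & alpha 0 = 0].

Definition posdef_sym (R : realType) (n : nat) (Q : 'M[R]_n) : Prop :=
  Q^T = Q /\ forall x : 'cV[R]_n, x != 0 -> 0 < (x^T *m Q *m x) 0 0.

Definition possemidef_sym (R : realType) (n : nat) (Q : 'M[R]_n) : Prop :=
  Q^T = Q /\ forall x : 'cV[R]_n, 0 <= (x^T *m Q *m x) 0 0.

Section ConstrainedSystem.
Variables (R : realType) (n m : nat).
Variable nrm : 'cV[R]_n -> R.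
Variable Y : set ('cV[R]_n * 'cV[R]_m).
Variable f : 'cV[R]_n -> 'cV[R]_m -> 'cV[R]_n.

Definition state_constraint : set 'cV[R]_n :=
  [set x | exists u : 'cV[R]_m, Y (x, u)].

Definition equilibrium (xe : 'cV[R]_n) (ue : 'cV[R]_m) : Prop :=
  Y (xe, ue) /\ xe = f xe ue.

(* Stage costs on Y and storage functions on the state constraint set are total
   functions; their values elsewhere are never used. *)
Definition optimal_equilibrium (l : 'cV[R]_n -> 'cV[R]_m -> R)
    (xe : 'cV[R]_n) (ue : 'cV[R]_m) : Prop :=
  equilibrium xe ue /\ forall x u, equilibrium x u -> l xe ue <= l x u.

Definition bounded_on_bounded (lam : 'cV[R]_n -> R) : Prop :=
  forall S : set 'cV[R]_n, S `<=` state_constraint ->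
    (exists r, forall x, S x -> nrm x <= r) ->
    exists c, forall x, S x -> `|lam x| <= c.

Definition bounded_below (lam : 'cV[R]_n -> R) : Prop :=
  exists c, forall x, state_constraint x -> c <= lam x.

Definition strict_dissipation (l : 'cV[R]_n -> 'cV[R]_m -> R)
    (xe : 'cV[R]_n) (ue : 'cV[R]_m)
    (lam : 'cV[R]_n -> R) (alpha : R -> R) : Prop :=
  forall x u, Y (x, u) -> state_constraint (f x u) ->
    alpha (nrm (x - xe)) <= l x u - l xe ue + lam x - lam (f x u).

Definition strictly_dissipative_at (l : 'cV[R]_n -> 'cV[R]_m -> R)
    (xe : 'cV[R]_n) (ue : 'cV[R]_m) : Prop :=
  equilibrium xe ue /\
  exists lam alpha,
    [/\ bounded_on_bounded lam, bounded_below lam, class_Kinf alpha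
      & strict_dissipation l xe ue lam alpha].

Definition strictly_dissipative (l : 'cV[R]_n -> 'cV[R]_m -> R) : Prop :=
  exists xe ue, strictly_dissipative_at l xe ue.

End ConstrainedSystem.

Definition linear_system (R : realType) (n m : nat)
    (A : 'M[R]_n) (B : 'M[R]_(n, m)) (x : 'cV[R]_n) (u : 'cV[R]_m) : 'cV[R]_n :=
  A *m x + B *m u.

Definition quadratic_cost (R : realType) (n m : nat)
    (Q : 'M[R]_n) (P : 'M[R]_m) (s : 'cV[R]_n) (v : 'cV[R]_m)
    (x : 'cV[R]_n) (u : 'cV[R]_m) : R :=
  (x^T *m Q *m x + u^T *m P *m u + s^T *m x + v^T *m u) 0 0.

Definition weighted_cost (R : realType) (n m : nat)
    (l1 l2 : 'cV[R]_n -> 'cV[R]_m -> R) (mu : R)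
    (x : 'cV[R]_n) (u : 'cV[R]_m) : R :=
  mu * l1 x u + (1 - mu) * l2 x u.

(* Main.v *)
Require Import Defs.
From HB Require Import structures.
From mathcomp Require Import all_boot all_order all_algebra.
From mathcomp Require Import all_classical all_reals all_analysis.
From mathcomp Require Import ring lra.

Set Implicit Arguments.
Unset Strict Implicit.
Unset Printing Implicit Defensive.

Import Order.TTheory GRing.Theory Num.Theory.
Import numFieldNormedType.Exports.

Local Open Scope classical_set_scope.
Local Open Scope ring_scope.

(** In coordinates [z = x - e], [w = u - ue] centred at the optimal equilibrium,
    a quadratic cost is a constant, plus a linear part, plus [z^T Q z + w^T P w].

    The linear part is harmless.  The equilibrium is interior to [Y], so the
    gradient of the cost vanishes on the directions with [z = A z + B w] and is
    therefore of the form [p^T (z - (A z + B w))] for a multiplier [p]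
    ([equilibrium_multiplier]).  The storage [- p^T z] absorbs it.  What remains to be
    found is a matrix [M] with
      [c |z|^2 <= z^T M z - (A z + B w)^T M (A z + B w) + k (z^T Q z + w^T P w)]
    ([lyapunov_certificate]): then [- p^T z + k^-1 z^T M z] is a strict storage
    function ([strictly_dissipative_of_certificate]), provided that it is bounded
    below, which is automatic on a compact [Y] and holds on the whole space if [M] is
    positive definite.

    Such an [M] is inherited by the combined costs: the quadratic part of the cost
    with weight [mu] is at least [mu] times that of the first cost and at least
    [1 - mu] times that of the second, so a certificate for one cost whose weight
    is positive, rescaled, is a certificate for the combination
    ([lyapunov_certificate_weight]).

    The core is thus that strict dissipativity at one cost, with an arbitrary
    storage and an arbitrary comparison function, produces a quadratic certificate.
    By a theorem of alternatives over the semidefinite cone ([sdp_alternative]), if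
    there is none then some [Z != 0] satisfies [Q Z = 0] and
    [Z Z^T = A Z Z^T A^T], or [Z Z^T + V V^T = A Z Z^T A^T] when [M] is also
    required to be positive definite.  Under the constant input [ue] the deviation
    [z] from the equilibrium becomes [A z].  The deviations started at the columns
    of [Z] stay in the column space of [Z], hence in the kernel of [Q], and their
    total squared length does not decrease; it is constant in the first case, so
    that after scaling the trajectories remain in [Y].  Adding
    the dissipation inequalities along a trajectory and its mirror image through
    the equilibrium cancels the linear part of the cost, and the quadratic part is
    zero; so the total storage drops at each step by an amount bounded away from
    zero, although it is bounded below ([no_persistent_trajectory]). *)

(** * Quadratic forms and factorization of semidefinite matrices *)

(** For [Q] the identity this is the Euclidean scalar product, so that linear
    terms of a cost obey the same algebraic rules as quadratic ones. *)
Definition bform (R : realType) (p q : nat) (Q : 'M[R]_(p, q))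
    (x : 'cV[R]_p) (y : 'cV[R]_q) : R :=
  (x^T *m Q *m y) 0 0.

Notation qform Q x := (bform Q x x).

(** The squared Frobenius norm, which is the squared Euclidean length for a
    column vector. *)
Definition sqn (R : realType) (p q : nat) (Z : 'M[R]_(p, q)) : R :=
  \tr (Z *m Z^T).

Section Forms.
Variable R : realType.
Implicit Types p q k : nat.

Lemma bformDr p q (Q : 'M[R]_(p, q)) x y z :
  bform Q x (y + z) = bform Q x y + bform Q x z.
Proof. by rewrite /bform mulmxDr mxE. Qed.

Lemma bformDl p q (Q : 'M[R]_(p, q)) x y z :
  bform Q (x + y) z = bform Q x z + bform Q y z.
Proof. by rewrite /bform linearD /= !mulmxDl mxE. Qed.

Lemma bformZr p q (Q : 'M[R]_(p, q)) a x y : bform Q x (a *: y) = a * bform Q x y.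
Proof. by rewrite /bform -scalemxAr mxE. Qed.

Lemma bformZl p q (Q : 'M[R]_(p, q)) a x y : bform Q (a *: x) y = a * bform Q x y.
Proof. by rewrite /bform linearZ /= -!scalemxAl mxE. Qed.

Lemma bformC p q (Q : 'M[R]_(p, q)) x y : bform Q x y = bform Q^T y x.
Proof.
rewrite /bform -[in LHS](trmxK (x^T *m Q *m y)) mxE !trmx_mul trmxK mulmxA.
by [].
Qed.

Lemma bformMD p q (Q1 Q2 : 'M[R]_(p, q)) x y :
  bform (Q1 + Q2) x y = bform Q1 x y + bform Q2 x y.
Proof. by rewrite /bform mulmxDr mulmxDl mxE. Qed.

Lemma bformMZ p q a (Q : 'M[R]_(p, q)) x y : bform (a *: Q) x y = a * bform Q x y.
Proof. by rewrite /bform -scalemxAr -scalemxAl mxE. Qed.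

Lemma bformMB p q (Q1 Q2 : 'M[R]_(p, q)) x y :
  bform (Q1 - Q2) x y = bform Q1 x y - bform Q2 x y.
Proof. by rewrite bformMD -scaleN1r bformMZ mulN1r. Qed.

Lemma qform_outer p (v y : 'cV[R]_p) :
  qform (v *m v^T) y = ((v^T *m y) 0 0) ^+ 2.
Proof.
rewrite /bform mulmxA -(mulmxA _ v^T) [y^T *m v]mx11_scalar mul_scalar_mx mxE expr2.
by congr (_ * _); rewrite -[y^T *m v]trmxK trmx_mul trmxK mxE.
Qed.

Lemma bform0r p q (Q : 'M[R]_(p, q)) x : bform Q x 0 = 0.
Proof. by rewrite -(scale0r 0) bformZr mul0r. Qed.

Lemma bform_congr p q r s (F : 'M[R]_(p, r)) (Q : 'M[R]_(p, q))
    (G : 'M[R]_(q, s)) x y :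
  bform (F^T *m Q *m G) x y = bform Q (F *m x) (G *m y).
Proof. by rewrite /bform trmx_mul !mulmxA. Qed.

Lemma bform_delta p q (Q : 'M[R]_(p, q)) i j :
  bform Q (delta_mx i 0) (delta_mx j 0) = Q i j.
Proof. by rewrite /bform trmx_delta -rowE -colE !mxE. Qed.

Lemma qform_tr p (Q : 'M[R]_p) x : qform Q x = \tr (Q *m (x *m x^T)).
Proof. by rewrite mulmxA mxtrace_mulC mulmxA trace_mx11. Qed.

Lemma sqn_cV p (x : 'cV[R]_p) : sqn x = \sum_i x i 0 ^+ 2.
Proof.
by rewrite /sqn /mxtrace; apply: eq_bigr => i _; rewrite mxE big_ord1 mxE expr2.
Qed.

Lemma sqnE p q (Z : 'M[R]_(p, q)) : sqn Z = \sum_i \sum_j Z i j ^+ 2.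
Proof.
rewrite /sqn /mxtrace; apply: eq_bigr => i _; rewrite mxE.
by apply: eq_bigr => j _; rewrite mxE expr2.
Qed.

Lemma sqn_ge0 p q (Z : 'M[R]_(p, q)) : 0 <= sqn Z.
Proof.
by rewrite sqnE; do 2![apply: sumr_ge0 => ? _]; rewrite sqr_ge0.
Qed.

Lemma sqn_entry p q (Z : 'M[R]_(p, q)) i j : Z i j ^+ 2 <= sqn Z.
Proof.
rewrite sqnE (bigD1 i) //= (bigD1 j) //= -addrA lerDl addr_ge0 //.
  by apply: sumr_ge0 => ? _; rewrite sqr_ge0.
by apply: sumr_ge0 => ? _; apply: sumr_ge0 => ? _; rewrite sqr_ge0.
Qed.

Lemma sqn_eq0 p q (Z : 'M[R]_(p, q)) : sqn Z = 0 -> Z = 0.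
Proof.
move=> Z0; apply/matrixP => i j; rewrite mxE; apply/eqP.
by rewrite -sqrf_eq0 eq_le sqr_ge0 andbT -Z0 sqn_entry.
Qed.

Lemma sqn_gt0 p q (Z : 'M[R]_(p, q)) : Z != 0 -> 0 < sqn Z.
Proof.
by move=> Z0; rewrite lt0r sqn_ge0 andbT; apply: contra Z0 => /eqP/sqn_eq0 ->.
Qed.

Lemma sqnZ p q a (Z : 'M[R]_(p, q)) : sqn (a *: Z) = a ^+ 2 * sqn Z.
Proof.
by rewrite /sqn linearZ /= -scalemxAl -scalemxAr scalerA mxtraceZ expr2.
Qed.

Lemma sqn0 p q : sqn (0 : 'M[R]_(p, q)) = 0.
Proof. by rewrite -(scale0r 0) sqnZ expr0n mul0r. Qed.

Lemma sqn_col_mx p q k (Z : 'M[R]_(p, k)) (V : 'M[R]_(q, k)) :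
  sqn (col_mx Z V) = sqn Z + sqn V.
Proof. by rewrite /sqn tr_col_mx mul_col_row mxtrace_block. Qed.

Lemma sqn_sum_col p q (Z : 'M[R]_(p, q)) : sqn Z = \sum_j sqn (col j Z).
Proof.
rewrite sqnE exchange_big; apply: eq_bigr => j _; rewrite sqn_cV.
by apply: eq_bigr => i _; rewrite mxE.
Qed.

Lemma sqn_col_le p q (Z : 'M[R]_(p, q)) j : sqn (col j Z) <= sqn Z.
Proof.
rewrite (sqn_sum_col Z) (bigD1 j) //= lerDl.
by apply: sumr_ge0 => i _; exact: sqn_ge0.
Qed.

Lemma psd_ge0 p (Q : 'M[R]_p) x : possemidef_sym Q -> 0 <= qform Q x.
Proof. by case=> _; apply. Qed.

(** The form is nonnegative at [x - t *: (Q *m x)] for every real [t], and this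
    quadratic polynomial in [t] has no constant term, so that its linear
    coefficient [- 2 * sqn (Q *m x)] vanishes. *)
Lemma psd_ker p (Q : 'M[R]_p) x : possemidef_sym Q -> qform Q x = 0 -> Q *m x = 0.
Proof.
move=> QP x0; apply: sqn_eq0.
set y := Q *m x; set a := qform Q y.
have symE : bform Q x y = bform Q y x by rewrite [LHS]bformC QP.1.
have yx : bform Q y x = sqn y.
  by rewrite /bform -mulmxA -/y /sqn mxtrace_mulC trace_mx11.
have a0 : 0 <= a := psd_ge0 y QP.
(* t minimises the polynomial up to the harmless replacement of a by 1 + a,
   which keeps the denominator positive. *)
set s := sqn y; pose t := s / (1 + a).
have := psd_ge0 (x + (- t) *: y) QP.
rewrite !(bformDl, bformDr, bformZl, bformZr) symE x0 yx -/a -/s => h.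
have st : s = t * (1 + a) by rewrite mulfVK // gt_eqF //; lra.
have : t ^+ 2 <= 0 by nra.
move=> t2; have t0 : t = 0 by apply/eqP; rewrite -sqrf_eq0 eq_le t2 sqr_ge0.
by rewrite st t0 mul0r.
Qed.

(** By the Cauchy-Schwarz inequality, the rank one form that is subtracted lies
    below the form of [S].  The difference has [x] in its kernel, which makes
    successive deflations terminate. *)
Lemma psd_deflate p (S : 'M[R]_p) x : possemidef_sym S -> 0 < qform S x ->
  possemidef_sym (S - (qform S x)^-1 *: (S *m x *m (S *m x)^T)).
Proof.
move=> SP a0; have symS := SP.1; split.
  by rewrite linearB /= symS linearZ /= trmx_mul trmxK.
move=> y; change (0 <= qform (S - (qform S x)^-1 *: (S *m x *m (S *m x)^T)) y).
set a := qform S x in a0 *.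
have -> : qform (S - a^-1 *: (S *m x *m (S *m x)^T)) y
    = qform S y - a^-1 * bform S x y ^+ 2.
  rewrite bformMB bformMZ qform_outer trmx_mul symS.
  by rewrite -/(bform S x y).
have := psd_ge0 (y + (- (a^-1 * bform S x y)) *: x) SP.
rewrite !(bformDl, bformDr, bformZl, bformZr) -/a [bform S y x]bformC symS.
have aV : a^-1 * a = 1 by rewrite mulVf // gt_eqF.
move: aV; set b := bform S x y; set i := a^-1 => aV h.
have e : i * b ^+ 2 * (i * a) = i * b ^+ 2 by rewrite aV mulr1.
by move: h; lra.
Qed.

(** Deflating at the basis vectors one after the other clears the matrix row by
    row; a vanishing pivot means, by [psd_ker], that the row is already zero. *)
Lemma psd_factor_rows p (i : nat) (S : 'M[R]_p) : possemidef_sym S ->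
  (forall j : 'I_p, (i <= j)%N -> row j S = 0) ->
  exists k (Z : 'M[R]_(p, k)), S = Z *m Z^T.
Proof.
elim: i S => [|i IH] S SP S0.
  exists 0%N, 0; rewrite mul0mx; apply/row_matrixP => j; rewrite S0 //.
  by rewrite row0.
have [ip|pi] := ltnP i p; last first.
  apply: IH => // j ij; have := ltn_ord j.
  by rewrite ltnNge (leq_trans pi ij).
pose o := Ordinal ip; pose x : 'cV[R]_p := delta_mx o 0.
have xE : (S *m x)^T = row o S by rewrite trmx_mul SP.1 trmx_delta -rowE.
have := psd_ge0 x SP; rewrite le_eqVlt => /orP[/eqP/esym x0|x0].
  apply: IH => // j; rewrite leq_eqVlt => /orP[/eqP ij|]; last exact: S0.
  have -> : j = o by apply: val_inj.
  by rewrite -xE (psd_ker SP x0) trmx0.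
have [||k [Z ZE]] := IH (S - (qform S x)^-1 *: (S *m x *m (S *m x)^T)).
- exact: psd_deflate.
- move=> j; rewrite leq_eqVlt => /orP[/eqP ij|ij].
    have -> : j = o by apply: val_inj.
    rewrite linearB linearZ /= !row_mul -xE trmx_mul SP.1.
    have -> : x^T *m S *m x = (qform S x)%:M by rewrite [LHS]mx11_scalar.
    by rewrite mul_scalar_mx scalerA mulVf ?gt_eqF // scale1r subrr.
  by rewrite linearB linearZ /= !row_mul S0 // !mul0mx scaler0 subrr.
pose r := Num.sqrt (qform S x)^-1.
exists (k + 1)%N, (row_mx Z (r *: (S *m x))).
rewrite tr_row_mx mul_row_col -ZE [(_ *: _)^T]linearZ /=.
rewrite -scalemxAl -scalemxAr scalerA.
by rewrite -expr2 sqr_sqrtr ?invr_ge0 ?(ltW x0) // subrK.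
Qed.

Lemma psd_factor p (S : 'M[R]_p) : possemidef_sym S ->
  exists k (Z : 'M[R]_(p, k)), S = Z *m Z^T.
Proof.
move=> SP; apply: (@psd_factor_rows _ p) => // j.
by rewrite leqNgt ltn_ord.
Qed.

Lemma psd_tr_ker p k (Q : 'M[R]_p) (Z : 'M[R]_(p, k)) : possemidef_sym Q ->
  \tr (Q *m (Z *m Z^T)) = 0 -> Q *m Z = 0.
Proof.
move=> QP.
have -> : \tr (Q *m (Z *m Z^T)) = \sum_j qform Q (col j Z).
  rewrite mulmxA mxtrace_mulC mulmxA /mxtrace; apply: eq_bigr => j _.
  by rewrite colE -bform_congr bform_delta.
move=> h; apply/matrixP => i j.
have /psd_ker -/(_ QP) : qform Q (col j Z) = 0.
  by apply/eqP; move/eqP: h; rewrite psumr_eq0 => [/allP/(_ j)|? _];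
    [rewrite mem_index_enum => /(_ isT)|exact: psd_ge0].
by rewrite colE mulmxA -colE => /colP/(_ i); rewrite !mxE.
Qed.

End Forms.

(** * Continuity and compactness for real matrices *)

Section Compactness.
Variable R : realType.
Implicit Types p q k : nat.

Lemma continuous_addr (T : topologicalType) (f g : T -> R) :
  continuous f -> continuous g -> continuous (fun x => f x + g x).
Proof. by move=> fC gC x; apply: cvgD; [exact: fC|exact: gC]. Qed.

Lemma continuous_mulr (T : topologicalType) (f g : T -> R) :
  continuous f -> continuous g -> continuous (fun x => f x * g x).
Proof. by move=> fC gC x; apply: cvgM; [exact: fC|exact: gC]. Qed.

Lemma continuous_sumr (T : topologicalType) I (r : seq I) (F : I -> T -> R) :
  (forall i, continuous (F i)) -> continuous (fun x => \sum_(i <- r) F i x).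
Proof.
move=> FC; elim: r => [|i r IH].
  by under eq_fun do rewrite big_nil; move=> x; exact: cvg_cst.
under eq_fun do rewrite big_cons.
by apply: continuous_addr.
Qed.

Lemma scalar_continuous p q (f : 'M[R]_(p, q) -> R) : scalar f -> continuous f.
Proof.
move=> fL.
have f0 : f 0 = 0.
  by move: (fL (-1) 0 0) => /=; rewrite scaler0 addr0 mulN1r addNr => ->.
have fD u v : f (u + v) = f u + f v.
  by rewrite -[u in LHS]scale1r fL mul1r.
have fZ a u : f (a *: u) = a * f u by rewrite -[_ *: u]addr0 fL f0 addr0.
have fS I (r : seq I) (F : I -> 'M[R]_(p, q)) :
    f (\sum_(i <- r) F i) = \sum_(i <- r) f (F i).
  exact: (big_morph f fD f0).
have -> : f = fun M => \sum_i \sum_j M i j * f (delta_mx i j).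
  apply/funext => M; rewrite {1}[M]matrix_sum_delta fS; apply: eq_bigr => i _.
  by rewrite fS; apply: eq_bigr => j _; rewrite fZ.
apply: continuous_sumr => i.
apply: continuous_sumr => j.
apply: continuous_mulr; [exact: coord_continuous|exact: cst_continuous].
Qed.

Lemma sqn_continuous p q : continuous (@sqn R p q).
Proof.
rewrite (_ : @sqn R p q = fun Z => \sum_i \sum_j Z i j * Z i j).
  apply: continuous_sumr => i.
  apply: continuous_sumr => j.
  by apply: continuous_mulr; exact: coord_continuous.
by apply/funext => Z; rewrite sqnE; under eq_bigr do under eq_bigr do rewrite expr2.
Qed.

Lemma bform_continuous p q (S : 'M[R]_(p, q)) (T : topologicalType)
    (x : T -> 'cV[R]_p) (y : T -> 'cV[R]_q) :
  (forall i, continuous (fun t => x t i 0)) ->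
  (forall j, continuous (fun t => y t j 0)) ->
  continuous (fun t => bform S (x t) (y t)).
Proof.
move=> xC yC.
have -> : (fun t => bform S (x t) (y t)) =
    fun t => \sum_j (\sum_i x t i 0 * S i j) * y t j 0.
  apply/funext => t; rewrite /bform mxE; apply: eq_bigr => j _; rewrite mxE.
  by under eq_bigr do rewrite mxE.
apply: continuous_sumr => j; apply: continuous_mulr; last exact: yC.
apply: continuous_sumr => i; apply: continuous_mulr; first exact: xC.
exact: cst_continuous.
Qed.

Lemma vec_mx_continuous p q : continuous (@vec_mx R p q).
Proof.
move=> v A /nbhs_ballP[e e0 eA]; apply/nbhs_ballP; exists e => //= w [_ vw].
by apply: eA; split=> // i j; rewrite !mxE.
Qed.

Lemma closed_bounded_mx_compact p q (A : set 'M[R]_(p, q)) (M : R) :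
  closed A -> (forall Z, A Z -> forall i j, `|Z i j| <= M) -> compact A.
Proof.
move=> Acl AM.
have -> : A = vec_mx @` (vec_mx @^-1` A).
  apply/seteqP; split=> [Z AZ|_ [v Av <-]//].
  by exists (mxvec Z); rewrite /= mxvecK.
apply: continuous_compact; first exact/continuous_subspaceT/vec_mx_continuous.
pose B := [set v : 'rV[R]_(p * q) | forall i, `[- M, M]%classic (v ord0 i)].
apply: (@subclosed_compact _ _ B).
- apply: (@preimage_closed _ _ (@vec_mx R p q) A); last exact: Acl.
  by move=> v _; exact: vec_mx_continuous.
- by apply: (@rV_compact _ _ (fun=> `[- M, M]%classic)) => i; exact: segment_compact.
- move=> v /= /AM vM i; have [{}i j] := mxvec_indexP i.
  by have := vM i j; rewrite mxE /= in_itv /= ler_norml.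
Qed.

Lemma compact_sqn_ball p (K : R) : compact [set x : 'cV[R]_p | sqn x <= K].
Proof.
apply: (@closed_bounded_mx_compact _ _ _ (Num.sqrt K)) => [|Z ZK i j].
  apply: (@preimage_closed _ _ (@sqn R p 1) [set x | x <= K]); last exact: closed_le.
  by move=> x _; exact: sqn_continuous.
by rewrite -sqrtr_sqr ler_wsqrtr // (le_trans (sqn_entry Z i j)).
Qed.

Lemma scalar_closed_le p q (f : 'M[R]_(p, q) -> R) a :
  scalar f -> closed [set Z | a <= f Z].
Proof.
move=> fL; apply: (@preimage_closed _ _ f [set x | a <= x]); last exact: closed_ge.
by move=> x _; exact: scalar_continuous.
Qed.

Lemma scalar_closed_eq p q (f : 'M[R]_(p, q) -> R) a :
  scalar f -> closed [set Z | f Z = a].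
Proof.
move=> fL; apply: (@preimage_closed _ _ f [set x | x = a]); last exact: closed_eq.
by move=> x _; exact: scalar_continuous.
Qed.

(** Testing the form at [e_i + e_j] and [e_i - e_j] bounds the entry [(i, j)] by
    the mean of two diagonal entries, hence by the trace. *)
Lemma compact_psd_trace1 p : compact [set S : 'M[R]_p | possemidef_sym S /\ \tr S = 1].
Proof.
apply: (@closed_bounded_mx_compact _ _ _ 1) => [|S [SP S1] i j].
- have -> : [set S : 'M[R]_p | possemidef_sym S /\ \tr S = 1] =
      (\bigcap_i \bigcap_j [set S : 'M[R]_p | S i j - S j i = 0]) `&`
      (\bigcap_x [set S | 0 <= qform S x]) `&` [set S | \tr S = 1].
    apply/seteqP; split=> S /=.
      move=> [[Ssym S0] S1]; split => //; split=> [i _ j _/=|x _]; last exact: S0.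
      by rewrite -{2}Ssym mxE subrr.
    move=> [[Ssym S0] S1]; split=> //; split=> [|x]; last exact: S0.
    apply/matrixP=> i j; apply/esym/eqP; rewrite mxE -subr_eq0; apply/eqP.
    exact: Ssym.
  apply: closedI; [apply: closedI|].
  + apply: closed_bigI => i _; apply: closed_bigI => j _.
    apply: (@scalar_closed_eq _ _ (fun S : 'M[R]_p => S i j - S j i)).
    by move=> a U V; rewrite !mxE mulrBr; ring.
  + apply: closed_bigI => x _; apply: (@scalar_closed_le _ _ (fun S : 'M[R]_p => qform S x)).
    by move=> a U V; rewrite bformMD bformMZ.
  + apply: (@scalar_closed_eq _ _ (fun S : 'M[R]_p => \tr S)).
    by move=> a U V; rewrite linearP.
- have diag (k : 'I_p) : 0 <= S k k by rewrite -bform_delta; exact: psd_ge0.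
  have ij2 : S i i + S j j <= 2.
    have tr (k : 'I_p) : S k k <= 1.
      rewrite -S1 /mxtrace (bigD1 k) //= lerDl; exact: sumr_ge0.
    by rewrite (_ : 2 = 1 + 1) // lerD.
  have ji : S j i = S i j by rewrite -{1}SP.1 mxE.
  rewrite ler_norml.
  have := psd_ge0 (delta_mx i 0 + (-1) *: delta_mx j 0) SP.
  have := psd_ge0 (delta_mx i 0 + delta_mx j 0) SP.
  rewrite !(bformDl, bformDr, bformZl, bformZr, bform_delta) ji => h1 h2.
  by apply/andP; split; lra.
Qed.

End Compactness.

(** * A theorem of alternatives over the semidefinite cone *)

Section Alternative.
Variable R : realType.

Lemma mxtr_dotC p q (X Y : 'M[R]_(p, q)) : \tr (X^T *m Y) = \tr (Y^T *m X).
Proof. by rewrite -mxtrace_tr trmx_mul trmxK. Qed.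

Lemma sqn_comb p q (a b : R) (X Y : 'M[R]_(p, q)) :
  sqn (a *: X + b *: Y) =
  a ^+ 2 * sqn X + 2 * (a * b) * \tr (X^T *m Y) + b ^+ 2 * sqn Y.
Proof.
have sqnT (Z : 'M[R]_(p, q)) : sqn Z = \tr (Z^T *m Z) by rewrite /sqn mxtrace_mulC.
have trE : (a *: X + b *: Y)^T = a *: X^T + b *: Y^T by rewrite linearD /= !linearZ.
rewrite !sqnT trE mulmxDr !mulmxDl -!scalemxAl -!scalemxAr !scalerA.
rewrite !mxtraceD !mxtraceZ (mxtr_dotC Y X); ring.
Qed.

Lemma psd_outer p (a : R) (y : 'cV[R]_p) : 0 <= a -> possemidef_sym (a *: (y *m y^T)).
Proof.
move=> a0; split=> [|x]; first by rewrite linearZ /= trmx_mul trmxK.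
change (0 <= qform (a *: (y *m y^T)) x).
by rewrite bformMZ qform_outer mulr_ge0 ?sqr_ge0.
Qed.

(** On the compact convex set of semidefinite [S] of trace 1, minimise
    [g S = sqn (Phi S) + (\tr (W *m S)) ^+ 2].  If the minimum is zero, a
    factor of the minimiser is a solution of the second kind.  Otherwise the
    minimiser [S0] separates the image of this set from the origin: pairing
    with [(Phi S0, \tr (W *m S0))] is bounded below by the minimum, and the first
    assertion is this bound at the normalised matrices [y *m y^T]. *)
Lemma sdp_alternative N p q (Phi : 'M[R]_N -> 'M[R]_(p, q)) (W : 'M[R]_N) :
  linear Phi -> possemidef_sym W ->
  (exists (P : 'M[R]_(p, q)) (k c : R), [/\ 0 < k, 0 < c &
     forall y : 'cV_N, c * sqn y <= \tr (P^T *m Phi (y *m y^T)) + k * qform W y]) \/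
  (exists k (Z : 'M[R]_(N, k)), [/\ Z != 0, Phi (Z *m Z^T) = 0 & W *m Z = 0]).
Proof.
move=> PhiL WP.
have Phi0 : Phi 0 = 0.
  by move: (PhiL (-1) 0 0) => /=; rewrite scaler0 addr0 scaleN1r addNr => ->.
have PhiD u v : Phi (u + v) = Phi u + Phi v by rewrite -[u in LHS]scale1r PhiL scale1r.
have PhiZ a u : Phi (a *: u) = a *: Phi u by rewrite -[_ *: u]addr0 PhiL Phi0 addr0.
have base (P : 'M[R]_(p, q)) (k c : R) :
    c * sqn (0 : 'cV[R]_N) <=
      \tr (P^T *m Phi (0 *m (0 : 'cV[R]_N)^T)) + k * qform W 0.
  by rewrite mul0mx Phi0 mulmx0 mxtrace0 sqn0 bform0r !mulr0 addr0.
set D := [set S : 'M[R]_N | possemidef_sym S /\ \tr S = 1].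
have Dy (y : 'cV[R]_N) : y != 0 -> D ((sqn y)^-1 *: (y *m y^T)).
  move=> /sqn_gt0 y0; split; first by apply: psd_outer; rewrite invr_ge0 ltW.
  by rewrite mxtraceZ mulVf // gt_eqF.
have [D0|/set0P Dne] := eqVneq D set0.
  left; exists 0, 1, 1; split=> // y; have [->|/Dy] := eqVneq y 0; last by rewrite D0.
  exact: base.
pose g S := sqn (Phi S) + \tr (W *m S) ^+ 2.
have gC : continuous g.
  have sc i j : scalar (fun S => Phi S i j) by move=> a u v; rewrite PhiD PhiZ !mxE.
  have -> : g = fun S =>
      (\sum_i \sum_j Phi S i j * Phi S i j) + \tr (W *m S) * \tr (W *m S).
    apply/funext => S; rewrite /g sqnE -expr2.
    by under eq_bigr do under eq_bigr do rewrite expr2.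
  have wC : continuous (fun S => \tr (W *m S)).
    apply: scalar_continuous => a u v.
    by rewrite mulmxDr -scalemxAr mxtraceD mxtraceZ.
  apply: continuous_addr; last by apply: continuous_mulr.
  apply: continuous_sumr => i.
  apply: continuous_sumr => j.
  by apply: continuous_mulr; exact: (scalar_continuous (sc i j)).
have [S0] := compact_EVT_min Dne (@compact_psd_trace1 R N) (continuous_subspaceT gC).
rewrite inE => -[S0P S01] gmin.
have g0 : 0 <= g S0 by rewrite addr_ge0 ?sqr_ge0 ?sqn_ge0.
move: g0; rewrite le_eqVlt => /orP[/eqP/esym /eqP gS0|gS0].
  right; have [k [Z ZE]] := psd_factor S0P; exists k, Z.
  move: gS0; rewrite /g paddr_eq0 ?sqr_ge0 ?sqn_ge0 // sqrf_eq0.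
  move=> /andP[/eqP/sqn_eq0 h1 /eqP h2].
  rewrite -ZE; split=> //; last by apply: psd_tr_ker; rewrite // -ZE.
  apply/eqP => Z0; move: S01; rewrite ZE Z0 mul0mx mxtrace0 => /eqP.
  by rewrite eq_sym oner_eq0.
pose r0 := \tr (W *m S0).
pose b S := \tr ((Phi S0)^T *m Phi S) + r0 * \tr (W *m S).
(* The minimum over the segment from S0 to S is attained at S0, so the
   derivative of g there in the direction S - S0 is nonnegative. *)
have key S : D S -> g S0 <= b S.
  move=> [SP S1]; rewrite leNgt; apply/negP => bS.
  (* At parameter t of the segment, g equals g S0 + t * (t * m - 2 * d); t is
     chosen so that t * m <= d. *)
  pose d := g S0 - b S; have d0 : 0 < d by rewrite subr_gt0.
  pose m := g S0 - 2 * b S + g S.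
  pose t := d / (`|m| + d).
  have md : 0 < `|m| + d by rewrite ltr_wpDl.
  have t0 : 0 < t by rewrite divr_gt0.
  have t1 : t <= 1 by rewrite ler_pdivrMr // mul1r lerDr.
  have St : D ((1 - t) *: S0 + t *: S).
    split; last by rewrite mxtraceD !mxtraceZ S01 S1 !mulr1 subrK.
    split=> [|x]; first by rewrite linearD /= !linearZ /= S0P.1 SP.1.
    change (0 <= qform ((1 - t) *: S0 + t *: S) x).
    rewrite bformMD !bformMZ addr_ge0 // mulr_ge0 ?psd_ge0 ?subr_ge0 //; exact: ltW.
  have := gmin _ (mem_set St).
  rewrite [leRHS]/g PhiD !PhiZ sqn_comb mulmxDr -!scalemxAr mxtraceD !mxtraceZ.
  have -> : (1 - t) ^+ 2 * sqn (Phi S0) +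
     2 * ((1 - t) * t) * \tr ((Phi S0)^T *m Phi S) + t ^+ 2 * sqn (Phi S) +
     ((1 - t) * \tr (W *m S0) + t * \tr (W *m S)) ^+ 2 =
     g S0 + t * (t * m - 2 * d) by rewrite /m /d /b /g /r0; ring.
  rewrite lerDl pmulr_rge0 // subr_ge0 => h.
  have : t * m <= d.
    have mm : t * m <= t * `|m| by rewrite ler_pM2l // ler_norm.
    have tmd : t * (`|m| + d) = d by rewrite mulfVK // gt_eqF.
    have td : 0 < t * d by rewrite mulr_gt0.
    by move: tmd; rewrite mulrDr; lra.
  lra.
(* Raising the coefficient of the form of W is harmless, since W is semidefinite,
   and makes it positive. *)
left; exists (Phi S0), (`|r0| + 1), (g S0).
split; [by rewrite ltr_wpDl|exact: gS0|].
move=> y; have [->|y0] := eqVneq y 0; first exact: base.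
have := key _ (Dy y y0); have sy := sqn_gt0 y0.
rewrite -(ler_pM2r sy) => /le_trans; apply.
rewrite /b PhiZ -!scalemxAr !mxtraceZ -qform_tr.
have -> : ((sqn y)^-1 * \tr ((Phi S0)^T *m Phi (y *m y^T)) +
   r0 * ((sqn y)^-1 * qform W y)) * sqn y =
   ((sqn y)^-1 * sqn y) * (\tr ((Phi S0)^T *m Phi (y *m y^T)) + r0 * qform W y) by ring.
rewrite mulVf ?gt_eqF // mul1r lerD2l ler_wpM2r ?psd_ge0 //.
by rewrite (le_trans (ler_norm _)) // lerDl.
Qed.

End Alternative.

(** * Comparison of an arbitrary norm with the Euclidean one *)

Section Norms.
Variables (R : realType) (n : nat) (nrm : 'cV[R]_n -> R).
Hypothesis nrmP : is_norm nrm.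

Lemma nrm0 : nrm 0 = 0.
Proof. by rewrite -(scale0r 0) (norm_scale nrmP) normr0 mul0r. Qed.

Lemma nrmN x : nrm (- x) = nrm x.
Proof. by rewrite -scaleN1r (norm_scale nrmP) normrN1 mul1r. Qed.

Lemma nrm_ge0 x : 0 <= nrm x.
Proof. by have := norm_triangle nrmP x (- x); rewrite subrr nrm0 nrmN; lra. Qed.

Lemma nrm_entries x : nrm x <= \sum_i `|x i 0| * nrm (delta_mx i 0).
Proof.
rewrite {1}[x]matrix_sum_delta.
under eq_bigr do rewrite big_ord1.
elim/big_ind2 : _ => [|x1 y1 x2 y2 h1 h2|i _]; first by rewrite nrm0.
  by rewrite (le_trans (norm_triangle nrmP _ _)) // lerD.
by rewrite (norm_scale nrmP).
Qed.

Lemma nrm_sqn_upper : exists2 b, 0 < b & forall x, nrm x ^+ 2 <= b * sqn x.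
Proof.
pose C := 1 + \sum_i nrm (delta_mx i 0).
have C0 : 0 < C by rewrite ltr_pwDl // sumr_ge0 // => i _; exact: nrm_ge0.
exists (C ^+ 2); first by rewrite exprn_gt0.
move=> x; rewrite -[sqn x]sqr_sqrtr ?sqn_ge0 // -exprMn.
rewrite ler_sqr ?nnegrE ?nrm_ge0 //; last first.
  by rewrite mulr_ge0 ?sqrtr_ge0 // ltW.
rewrite (le_trans (nrm_entries x)) // mulrDl mul1r mulr_suml ler_wpDl ?sqrtr_ge0 //.
apply: ler_sum => i _; rewrite mulrC ler_wpM2l ?nrm_ge0 //.
by rewrite -sqrtr_sqr ler_wsqrtr // sqn_entry.
Qed.

Lemma nrm_continuous : continuous nrm.
Proof.
pose C := 1 + \sum_i nrm (delta_mx i 0).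
have C0 : 0 < C by rewrite ltr_pwDl // sumr_ge0 // => i _; exact: nrm_ge0.
move=> x A /nbhs_ballP[e /= e0 eA]; apply/nbhs_ballP; exists (e / C) => /=.
  by rewrite divr_gt0.
move=> y [_ xy]; apply: eA.
have h : nrm (x - y) < e.
  rewrite (le_lt_trans (nrm_entries _)) //.
  rewrite (@le_lt_trans _ _ (e / C * \sum_i nrm (delta_mx i 0))) //.
    rewrite mulr_sumr; apply: ler_sum => i _; rewrite ler_wpM2r ?nrm_ge0 //.
    by have := xy i 0; rewrite /ball /= !mxE => /ltW.
  rewrite -[ltRHS](@mulfVK _ C) ?gt_eqF // ltr_pM2l ?divr_gt0 //.
  by rewrite /C ltrDr.
have h1 := norm_triangle nrmP (x - y) y; rewrite subrK in h1.
have h2 := norm_triangle nrmP (y - x) x; rewrite subrK -opprB nrmN in h2.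
by rewrite /ball /= ltr_norml; apply/andP; split; lra.
Qed.

(** The minimum of the norm on the compact Euclidean unit sphere is positive by
    definiteness. *)
Lemma nrm_sqn_lower : exists2 a, 0 < a & forall x, a * sqn x <= nrm x ^+ 2.
Proof.
pose D := [set x : 'cV[R]_n | sqn x = 1].
have Dx x : x != 0 -> D ((Num.sqrt (sqn x))^-1 *: x).
  move=> /sqn_gt0 x0; rewrite /D /= sqnZ exprVn sqr_sqrtr ?ltW //.
  by rewrite mulVf // gt_eqF.
have [D0|/set0P Dne] := eqVneq D set0.
  exists 1 => // x; have [->|/Dx] := eqVneq x 0; last by rewrite D0.
  by rewrite sqn0 mulr0 sqr_ge0.
have Dc : compact D.
  apply: (subclosed_compact _ (@compact_sqn_ball R n 1)).
    apply: (@preimage_closed _ _ (@sqn R n 1) [set x | x = 1]); last exact: closed_eq.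
    by move=> x _; exact: sqn_continuous.
  by move=> x /= ->.
have [x0] := compact_EVT_min Dne Dc (continuous_subspaceT nrm_continuous).
rewrite inE => x01 xmin.
have nx0 : 0 < nrm x0.
  rewrite lt0r nrm_ge0 andbT; apply/eqP => /(norm_definite nrmP) x00.
  by move: x01; rewrite /D /= x00 sqn0 => /eqP; rewrite eq_sym oner_eq0.
exists (nrm x0 ^+ 2); first by rewrite exprn_gt0.
move=> x; have [->|xN0] := eqVneq x 0.
  by rewrite sqn0 mulr0 sqr_ge0.
have := xmin _ (mem_set (Dx x xN0)).
have sx := sqn_gt0 xN0; have rx : 0 < Num.sqrt (sqn x) by rewrite sqrtr_gt0.
rewrite (norm_scale nrmP) ger0_norm ?invr_ge0 ?(ltW rx) // mulrC ler_pdivlMr // => h.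
rewrite -[sqn x]sqr_sqrtr ?sqn_ge0 // -exprMn ler_sqr ?nnegrE ?nrm_ge0 //.
by rewrite mulr_ge0 // ltW.
Qed.

End Norms.

(** * Trajectories that neither decay nor become visible *)

Section Persistence.
Variable R : realType.
Implicit Types p q k : nat.

(** The left kernel of [A *m Z] kills [Z], so the column space of [Z] lies in that
    of [A *m Z]; the latter has no larger dimension, hence the two coincide. *)
Lemma mul_range_stable p k k' (A : 'M[R]_p) (Z : 'M[R]_(p, k)) (V : 'M[R]_(p, k')) :
  Z *m Z^T + V *m V^T = A *m Z *m (A *m Z)^T -> exists H, A *m Z = Z *m H.
Proof.
move=> ZV; pose Y := (A *m Z)^T.
have ZY : (Z^T <= Y)%MS.
  rewrite submxE; apply/eqP/sqn_eq0; set y := cokermx Y.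
  have y0 : (A *m Z)^T *m y = 0 by exact: mulmx_coker.
  have sq q (X : 'M[R]_(p, q)) : sqn (X^T *m y) = \tr (y^T *m (X *m X^T) *m y).
    by rewrite /sqn mxtrace_mulC trmx_mul trmxK !mulmxA.
  have : sqn (Z^T *m y) + sqn (V^T *m y) = 0.
    rewrite !sq -mxtraceD -mulmxDl -mulmxDr ZV -(mulmxA y^T) -(mulmxA (A *m Z)).
    by rewrite y0 !mulmx0 mxtrace0.
  by move=> /eqP; rewrite paddr_eq0 ?sqn_ge0 // => /andP[/eqP].
have YZ : (Y <= Z^T)%MS.
  rewrite -(mxrank_leqif_sup ZY) eqn_leq (mxrank_leqif_sup ZY) /=.
  by rewrite /Y trmx_mul mxrankM_maxl.
have [H YE] := submxP YZ.
by exists H^T; rewrite -[LHS]trmxK -/Y YE trmx_mul trmxK.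
Qed.

Lemma iter_mul_range p k k' q (A : 'M[R]_p) (Z : 'M[R]_(p, k)) (V : 'M[R]_(p, k'))
    (Q : 'M[R]_(q, p)) t :
  Z *m Z^T + V *m V^T = A *m Z *m (A *m Z)^T -> Q *m Z = 0 ->
  Q *m iter t (mulmx A) Z = 0.
Proof.
move=> /mul_range_stable[H AZ] QZ.
have [Ht ->] : exists Ht, iter t (mulmx A) Z = Z *m Ht.
  elim: t => [|t [Ht IH]]; first by exists 1%:M; rewrite mulmx1.
  by exists (H *m Ht); rewrite iterS IH !mulmxA AZ.
by rewrite mulmxA QZ mul0mx.
Qed.

Lemma sqn_iter p k k' (A : 'M[R]_p) (Z : 'M[R]_(p, k)) (V : 'M[R]_(p, k')) t :
  Z *m Z^T + V *m V^T = A *m Z *m (A *m Z)^T ->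
  sqn (iter t.+1 (mulmx A) Z) =
  sqn (iter t (mulmx A) Z) + sqn (iter t (mulmx A) V).
Proof.
move=> ZV; rewrite /sqn -mxtraceD; congr mxtrace.
elim: t => [|t IH]; first by rewrite -ZV.
set Z1 := iter t.+1 (mulmx A) Z in IH *; set Z0 := iter t _ Z in IH.
set V0 := iter t _ V in IH.
have -> : iter t.+2 (mulmx A) Z = A *m Z1 by [].
have -> : iter t.+1 (mulmx A) V = A *m V0 by [].
rewrite (trmx_mul A Z1) (trmx_mul A V0) mulmxA -(mulmxA A) [in LHS]IH mulmxDr mulmxDl.
by rewrite (_ : Z1 = A *m Z0) // (trmx_mul A Z0) !mulmxA.
Qed.

Lemma sqn_iter_ge p k k' (A : 'M[R]_p) (Z : 'M[R]_(p, k)) (V : 'M[R]_(p, k')) t :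
  Z *m Z^T + V *m V^T = A *m Z *m (A *m Z)^T ->
  sqn Z <= sqn (iter t (mulmx A) Z).
Proof.
move=> ZV; elim: t => [//|t /le_trans]; apply.
by rewrite (sqn_iter _ ZV) lerDl sqn_ge0.
Qed.

Lemma sqn_iter_eq p k (A : 'M[R]_p) (Z : 'M[R]_(p, k)) t :
  Z *m Z^T = A *m Z *m (A *m Z)^T -> sqn (iter t (mulmx A) Z) = sqn Z.
Proof.
move=> ZZ; pose V : 'cV[R]_p := 0.
have ZV : Z *m Z^T + V *m V^T = A *m Z *m (A *m Z)^T by rewrite mul0mx addr0.
elim: t => [//|t IH]; rewrite (sqn_iter _ ZV) IH.
have -> : iter t (mulmx A) V = 0.
  by elim: t {IH} => [//|t IH]; rewrite iterS IH mulmx0.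
by rewrite sqn0 addr0.
Qed.

End Persistence.

(** * Expansion of a quadratic cost *)

Section Cost.
Variables (R : realType) (n m : nat).
Variables (Q : 'M[R]_n) (P : 'M[R]_m) (s : 'cV[R]_n) (v : 'cV[R]_m).
Hypotheses (symQ : Q^T = Q) (symP : P^T = P).

Let l := quadratic_cost Q P s v.

Lemma quadratic_cost_bform x u :
  l x u = qform Q x + qform P u + bform 1%:M s x + bform 1%:M v u.
Proof. by rewrite /l /quadratic_cost /bform !mulmx1 !mxE. Qed.

Lemma quadratic_cost_taylor x u z w :
  l (x + z) (u + w) = l x u + (qform Q z + qform P w) +
    (bform 1%:M (2 *: (Q *m x) + s) z + bform 1%:M (2 *: (P *m u) + v) w).
Proof.
have lin p (S : 'M[R]_p) (a b : 'cV[R]_p) : S^T = S ->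
    bform 1%:M (S *m a) b = bform S a b.
  by move=> symS; rewrite /bform mulmx1 trmx_mul symS.
rewrite !quadratic_cost_bform !(bformDl, bformDr) !bformZl !lin //.
rewrite [bform Q z x]bformC symQ [bform P w u]bformC symP; ring.
Qed.

Lemma quadratic_cost_second_difference x u z :
  l (x + z) u + l (x - z) u = 2 * l x u + 2 * qform Q z.
Proof.
have T z1 := quadratic_cost_taylor x u z1 0.
move: (T z) (T (- z)); rewrite !addr0 => -> ->.
rewrite -scaleN1r !(bformZl, bformZr).
rewrite !bform0r; ring.
Qed.

End Cost.

(** * What strict dissipativity forbids *)

Section Necessity.
Variables (R : realType) (n m : nat) (nrm : 'cV[R]_n -> R).
Hypothesis nrmP : is_norm nrm.
Variables (Y : set ('cV[R]_n * 'cV[R]_m)).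

Lemma class_Kinf_ge0 (alpha : R -> R) r : class_Kinf alpha -> 0 <= r -> 0 <= alpha r.
Proof. by case=> _ + _ _ _; apply. Qed.

Lemma class_Kinf_gt0 (alpha : R -> R) r : class_Kinf alpha -> 0 < r -> 0 < alpha r.
Proof. by case=> _ _ h _ a0 r0; rewrite -a0; apply: h. Qed.

Lemma class_Kinf_le (alpha : R -> R) r t : class_Kinf alpha -> 0 <= r -> r <= t ->
  alpha r <= alpha t.
Proof.
case=> _ _ h _ _ r0; rewrite le_eqVlt => /orP[/eqP->//|rt].
by apply: ltW; exact: h.
Qed.

(** The dissipation inequality at an equilibrium [(e, u)] carries no storage
    term.  At an optimal one it shows that the equilibrium of the hypothesis has
    the same state and the same cost, and its inequality only involves these. *)
Lemma dissipative_at_optimal (f : 'cV[R]_n -> 'cV[R]_m -> 'cV[R]_n) l e u :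
  strictly_dissipative nrm Y f l -> optimal_equilibrium Y f l e u ->
  exists lam alpha, [/\ bounded_below Y lam, class_Kinf alpha
    & strict_dissipation nrm Y f l e u lam alpha].
Proof.
move=> [e1 [u1 [eq1 [lam [alpha [_ lb Ka diss]]]]]] [[Ye fe] opt].
have l1 := opt _ _ eq1.
have := diss _ _ Ye; rewrite -fe addrK => /(_ (ex_intro _ u Ye)) h.
have a0 := class_Kinf_ge0 Ka (nrm_ge0 nrmP (e - e1)).
have e1E : e1 = e.
  apply/esym/subr0_eq/(norm_definite nrmP)/eqP; rewrite eq_le (nrm_ge0 nrmP) andbT leNgt.
  by apply/negP => /(class_Kinf_gt0 Ka); lra.
exists lam, alpha; split=> // x w Yx Xx.
have := diss _ _ Yx Xx; rewrite e1E.
suff -> : l e u = l e u1 by [].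
rewrite e1E in h l1 a0; lra.
Qed.

Variables (A : 'M[R]_n) (B : 'M[R]_(n, m)).
Variables (Q : 'M[R]_n) (P : 'M[R]_m) (s : 'cV[R]_n) (v : 'cV[R]_m).
Hypotheses (symQ : Q^T = Q) (symP : P^T = P).
Let f := linear_system A B.
Let l := quadratic_cost Q P s v.

(** The storage of the two trajectories starting at [e + z] and [e - z] and driven
    by the constant input [u] decreases in total at each step, since the linear terms
    of the cost cancel and the quadratic term vanishes.  The decrease
    does not fade, which contradicts the lower bound on the storage. *)
Lemma no_persistent_trajectory e u lam alpha k (Z : 'M[R]_(n, k)) (d : R) :
  e = f e u -> bounded_below Y lam -> class_Kinf alpha ->
  strict_dissipation nrm Y f l e u lam alpha ->
  0 < d ->
  (forall t, d <= sqn (iter t (mulmx A) Z)) ->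
  (forall t, Q *m iter t (mulmx A) Z = 0) ->
  (forall t j, Y (e + col j (iter t (mulmx A) Z), u) /\
               Y (e - col j (iter t (mulmx A) Z), u)) -> False.
Proof.
move=> fe [c lamc] Ka diss d0 dZ QZ YZ.
pose z t j := col j (iter t (mulmx A) Z).
have zS t j : A *m z t j = z t.+1 j by rewrite /z iterS !colE mulmxA.
have fz t j : f (e + z t j) u = e + z t.+1 j.
  by rewrite /f /linear_system mulmxDr addrAC -/(linear_system A B e u) -/f -fe zS.
have fNz t j : f (e - z t j) u = e - z t.+1 j.
  by rewrite /f /linear_system mulmxBr addrAC -/(linear_system A B e u) -/f -fe zS.
have qz t j : qform Q (z t j) = 0.
  by rewrite /z /bform -mulmxA colE (mulmxA Q) QZ mul0mx mulmx0 mxE.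
pose G t := \sum_j (lam (e + z t j) + lam (e - z t j)).
have [a a0 nrma] := nrm_sqn_lower nrmP.
pose r := Num.sqrt (a * (d / k.+1%:R)).
have k0 : 0 < k.+1%:R :> R by rewrite ltr0n.
have r20 : 0 < a * (d / k.+1%:R) by rewrite !mulr_gt0 ?invr_gt0.
have r0 : 0 < r by rewrite sqrtr_gt0.
have large t : exists j, r <= nrm (z t j).
  apply: contrapT => /forallNP small.
  have zs j : sqn (z t j) <= d / k.+1%:R.
    rewrite -(ler_pM2l a0) (le_trans (nrma _)) // -[leRHS]sqr_sqrtr ?(ltW r20) //.
    rewrite ler_sqr ?nnegrE ?(nrm_ge0 nrmP) ?sqrtr_ge0 // ltW // ltNge.
    exact/negP/small.
  have := dZ t; rewrite sqn_sum_col leNgt => /negP; apply.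
  rewrite (@le_lt_trans _ _ (\sum_(j < k) d / k.+1%:R)) //.
    by apply: ler_sum => j _; exact: zs.
  rewrite sumr_const card_ord -[_ *+ k]mulr_natl mulrA ltr_pdivrMr // mulrC ltr_pM2l //.
  by rewrite ltr_nat.
have G_dec t : G t.+1 <= G t - alpha r.
  have step j : alpha (nrm (z t j)) <=
      (lam (e + z t j) + lam (e - z t j)) - (lam (e + z t.+1 j) + lam (e - z t.+1 j)).
    have [Yp Yn] := YZ t j; have [Yp1 Yn1] := YZ t.+1 j.
    have := diss _ _ Yp; rewrite fz => /(_ (ex_intro _ u Yp1)).
    have := diss _ _ Yn; rewrite fNz => /(_ (ex_intro _ u Yn1)).
    have -> : e - z t j - e = - z t j by rewrite addrC addKr.
    have -> : e + z t j - e = z t j by rewrite addrC addKr.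
    rewrite (nrmN nrmP).
    have := quadratic_cost_second_difference s v symQ symP e u (z t j).
    rewrite qz -/l -/(z t j) => h2.
    have := class_Kinf_ge0 Ka (nrm_ge0 nrmP (z t j)).
    lra.
  have [j rj] := large t.
  have : alpha r <= \sum_j alpha (nrm (z t j)).
    rewrite (bigD1 j) //= (le_trans (class_Kinf_le Ka (ltW r0) rj)) // lerDl.
    by apply: sumr_ge0 => i _; apply: class_Kinf_ge0 (nrm_ge0 nrmP _).
  have : \sum_j alpha (nrm (z t j)) <= G t - G t.+1.
    by rewrite /G -sumrB; apply: ler_sum => i _; exact: step.
  lra.
have Gt t : G t <= G 0%N - t%:R * alpha r.
  elim: t => [|t IH]; first by rewrite mul0r subr0.
  by rewrite (le_trans (G_dec t)) // -natr1 mulrDl mul1r; lra.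
have G_ge t : k%:R * (2 * c) <= G t.
  have -> : k%:R * (2 * c) = \sum_(j < k) (2 * c).
    by rewrite sumr_const card_ord -[RHS]mulr_natl.
  apply: ler_sum => j _; have [Yp Yn] := YZ t j.
  have := lamc _ (ex_intro _ u Yp); have := lamc _ (ex_intro _ u Yn).
  rewrite -/(z t j); lra.
have ar0 := class_Kinf_gt0 Ka r0.
pose M := (G 0%N - k%:R * (2 * c)) / alpha r.
have := archi_boundP (normr_ge0 M); set N := Num.bound _ => NM.
have : M < N%:R by rewrite (le_lt_trans (ler_norm _)).
rewrite ltr_pdivrMr //; have := Gt N; have := G_ge N; lra.
Qed.

End Necessity.

(** * Quadratic storage functions extracted from dissipativity *)

Section Certificates.
Variables (R : realType) (n m : nat) (nrm : 'cV[R]_n -> R).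
Hypothesis nrmP : is_norm nrm.

(** This is [sdp_alternative] for [S |-> E S E^T + G S G^T - F S F^T].  The
    matrices [E] and [F] will give the state before and after a step, and [G] will
    carry the sign condition on the storage. *)
Lemma lyapunov_alternative N p (E G F : 'M[R]_(p, N)) (W : 'M[R]_N) :
  possemidef_sym W ->
  (exists (P : 'M[R]_p) (k c : R), [/\ 0 < k, 0 < c & forall y : 'cV_N,
     c * sqn y <= qform P (E *m y) + qform P (G *m y) - qform P (F *m y)
                  + k * qform W y]) \/
  (exists k (Z : 'M[R]_(N, k)), [/\ Z != 0, W *m Z = 0 &
     E *m Z *m (E *m Z)^T + G *m Z *m (G *m Z)^T = F *m Z *m (F *m Z)^T]).
Proof.
move=> WP.
pose Phi (S : 'M[R]_N) := E *m S *m E^T + G *m S *m G^T - F *m S *m F^T.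
have PhiL : linear Phi.
  have regroup (a : R) (x1 x2 x3 y1 y2 y3 : 'M[R]_p) :
      a *: x1 + y1 + (a *: x2 + y2) - (a *: x3 + y3) =
      a *: (x1 + x2 - x3) + (y1 + y2 - y3).
    by apply/matrixP => i j; rewrite !mxE; ring.
  by move=> a S T; rewrite /Phi !mulmxDr !mulmxDl -!scalemxAr -!scalemxAl regroup.
have PhiZ k (Z : 'M[R]_(N, k)) : Phi (Z *m Z^T) =
    E *m Z *m (E *m Z)^T + G *m Z *m (G *m Z)^T - F *m Z *m (F *m Z)^T.
  by rewrite /Phi !trmx_mul !mulmxA.
have [[P [k [c [k0 c0 Pc]]]]|[k [Z [Z0 PZ WZ]]]] := sdp_alternative PhiL WP;
  [left|right].
  exists P^T, k, c; split=> // y; have := Pc y.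
  by rewrite PhiZ mulmxBr mulmxDr linearB /= mxtraceD -!qform_tr.
by exists k, Z; split=> //; apply/eqP; rewrite -subr_eq0 -PhiZ PZ.
Qed.

Lemma qform_block p q (Q : 'M[R]_p) (P : 'M[R]_q) z w :
  qform (block_mx Q 0 0 P) (col_mx z w) = qform Q z + qform P w.
Proof.
by rewrite /bform tr_col_mx mul_row_block !mulmx0 addr0 add0r mul_row_col mxE.
Qed.

Lemma psd_block p q (Q : 'M[R]_p) (P : 'M[R]_q) :
  possemidef_sym Q -> possemidef_sym P -> possemidef_sym (block_mx Q 0 0 P).
Proof.
move=> QP PP; split=> [|x]; first by rewrite tr_block_mx QP.1 PP.1 !trmx0.
rewrite -[x]vsubmxK -/(bform _ _ _) qform_block; apply: addr_ge0; exact: psd_ge0.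
Qed.

Lemma posdef_psd p (P : 'M[R]_p) : posdef_sym P -> possemidef_sym P.
Proof.
move=> [symP P0]; split=> // x; have [->|/P0/ltW//] := eqVneq x 0.
by rewrite mulmx0 mxE.
Qed.

Lemma posdef_ker p k (P : 'M[R]_p) (Z : 'M[R]_(p, k)) :
  posdef_sym P -> P *m Z = 0 -> Z = 0.
Proof.
move=> [_ P0] PZ; apply/matrixP => i j; rewrite mxE.
suff /colP/(_ i) : col j Z = 0 by rewrite !mxE.
apply/eqP; apply: contraT => /P0.
by rewrite -mulmxA colE (mulmxA P) PZ mul0mx mulmx0 mxE ltxx.
Qed.

(** Since [sqn] is a squared length, [r] is the square of the radius. *)
Definition contains_ball (Y : set ('cV[R]_n * 'cV[R]_m)) e u (r : R) :=
  forall z w, sqn z < r -> sqn w < r -> Y (e + z, u + w).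

Lemma interior_ball (Y : set ('cV[R]_n * 'cV[R]_m)) e u :
  Y° (e, u) -> exists2 r, 0 < r & contains_ball Y e u r.
Proof.
move=> /nbhs_ballP[r /= r0 rY]; exists (r ^+ 2); first by rewrite exprn_gt0.
have small p (x z : 'cV[R]_p) : sqn z < r ^+ 2 -> ball x r (x + z).
  move=> zr; split=> // i j; rewrite /ball /= !mxE opprD addrA subrr add0r normrN.
  have : z i j ^+ 2 < r ^+ 2 by rewrite (le_lt_trans (sqn_entry z i j)).
  by rewrite -[z i j ^+ 2]real_normK ?num_real // ltr_sqr ?nnegrE // ltW.
by move=> z w zr wr; apply: rY; split; exact: small.
Qed.

Variables (A : 'M[R]_n) (B : 'M[R]_(n, m)).
Variables (Q : 'M[R]_n) (P : 'M[R]_m) (s : 'cV[R]_n) (v : 'cV[R]_m).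
Hypotheses (QP : possemidef_sym Q) (PP : posdef_sym P).
Let f := linear_system A B.
Let l := quadratic_cost Q P s v.

(** The dissipation inequality for the storage [qform M] and [k] times the
    quadratic part of the cost, in coordinates centred at an equilibrium. *)
Definition lyapunov_certificate (M : 'M[R]_n) (k c : R) :=
  [/\ 0 < k, 0 < c & forall z w, c * sqn z <=
     qform M z - qform M (f z w) + k * (qform Q z + qform P w)].

Variables (Y : set ('cV[R]_n * 'cV[R]_m)) (e : 'cV[R]_n) (u : 'cV[R]_m).
Hypotheses (diss : strictly_dissipative nrm Y f l).
Hypotheses (opt : optimal_equilibrium Y f l e u).

(** If no certificate exists, the alternative yields [Z1 != 0] with
    [Q *m Z1 = 0] and [Z1 *m Z1^T] invariant under [A].  Its iterates have constant
    Frobenius norm, so a small multiple of [Z1] has all its trajectories inside the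
    ball, and they contradict dissipativity by [no_persistent_trajectory]. *)
Lemma lyapunov_of_dissipative_ball r : 0 < r -> contains_ball Y e u r ->
  exists M k c, lyapunov_certificate M k c.
Proof.
move=> r0 rY; have PP' := posdef_psd PP.
have [[M [k [c [k0 c0 Mc]]]]|[k [Z [Z0 WZ EZ]]]] :=
  lyapunov_alternative (row_mx 1%:M 0) 0 (row_mx A B) (psd_block QP PP').
  exists M, k, c; split=> // z w; have := Mc (col_mx z w).
  rewrite !mul_row_col mul1mx !mul0mx addr0 qform_block sqn_col_mx.
  rewrite bform0r addr0 -/(f z w); apply: le_trans.
  by rewrite ler_pM2l // lerDl sqn_ge0.
move: EZ Z0 WZ; rewrite -[Z]vsubmxK; set Z1 := usubmx Z; set Z2 := dsubmx Z.
rewrite !mul_row_col mul1mx !mul0mx !addr0 mul_block_col !mul0mx addr0 add0r.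
move=> EZ Z0 WZ.
have [QZ1 PZ2] : Q *m Z1 = 0 /\ P *m Z2 = 0.
  by apply: eq_col_mx; rewrite WZ col_mx0.
move: EZ Z0; rewrite (posdef_ker PP PZ2) mulmx0 addr0 => EZ Z0.
have {}Z0 : Z1 != 0 by apply: contra Z0 => /eqP ->; rewrite col_mx0.
have sZ := sqn_gt0 Z0.
pose a := Num.sqrt (r / 2 / sqn Z1).
have aZ : sqn (a *: Z1) = r / 2.
  by rewrite sqnZ sqr_sqrtr ?mulfVK ?gt_eqF // !divr_ge0 // ltW.
have Y0 : a *: Z1 *m (a *: Z1)^T = A *m (a *: Z1) *m (A *m (a *: Z1))^T.
  rewrite -scalemxAr linearZ /= [(_ *: (A *m Z1))^T]linearZ /=.
  by rewrite -!scalemxAr -!scalemxAl EZ.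
have [lam [alpha [lb Ka di]]] := dissipative_at_optimal nrmP diss opt.
have eqt t : sqn (iter t (mulmx A) (a *: Z1)) = r / 2 by rewrite (sqn_iter_eq _ Y0).
exfalso; apply: (@no_persistent_trajectory _ _ _ _ nrmP Y A B Q P s v QP.1 PP.1
  e u lam alpha _ (a *: Z1) (r / 2)) => //.
- exact: opt.1.2.
- by rewrite divr_gt0.
- by move=> t; rewrite eqt.
- move=> t; apply: (iter_mul_range (V := 0 : 'cV[R]_n)).
    by rewrite mul0mx addr0.
  by rewrite -scalemxAr QZ1 scaler0.
- move=> t j; set z := col j _.
  have zr : sqn z < r.
    have : sqn z <= r / 2.
      by rewrite -(eqt t) sqn_col_le.
    by move=> h; lra.
  have z0 : sqn (0 : 'cV[R]_m) < r by rewrite sqn0.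
  split; first by have := rY _ _ zr z0; rewrite addr0.
  have zN : sqn (- z) < r by rewrite -scaleN1r sqnZ sqrrN expr1n mul1r.
  by have := rY _ _ zN z0; rewrite addr0.
Qed.

(** Without constraints the storage must moreover be bounded below, so [M] has to
    be positive definite.  Requiring this in the alternative adds a term
    [V *m V^T] to the equation for [Z1]: the iterates may now grow, which is
    harmless since they cannot leave [Y]. *)
Lemma lyapunov_of_dissipative_full : Y = setT ->
  exists M k c, lyapunov_certificate M k c /\ forall z, c * sqn z <= qform M z.
Proof.
move=> YT; have PP' := posdef_psd PP.
have Q0 : possemidef_sym (0 : 'M[R]_n).
  by split=> [|x]; rewrite ?trmx0 // mulmx0 mul0mx mxE.
have [[M [k [c [k0 c0 Mc]]]]|[k [Z [Z0 WZ EZ]]]] :=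
  lyapunov_alternative (row_mx (row_mx 1%:M 0) 0) (row_mx 0 1%:M)
    (row_mx (row_mx A B) 0)
    (psd_block (psd_block QP PP') Q0).
  have Mc' z w x : c * (sqn z + sqn w + sqn x) <=
      qform M z + qform M x - qform M (f z w) + k * (qform Q z + qform P w).
    have := Mc (col_mx (col_mx z w) x).
    rewrite !mul_row_col !mul1mx !mul0mx !addr0 !add0r !qform_block !sqn_col_mx.
    have -> : qform (0 : 'M[R]_n) x = 0 by rewrite /bform mulmx0 mul0mx mxE.
    by rewrite addr0.
  exists M, k, c; split; [split=> // z w|move=> x].
    have := Mc' z w 0; rewrite bform0r sqn0 !addr0; apply: le_trans.
    by rewrite ler_pM2l // lerDl sqn_ge0.
  have := Mc' 0 0 x; rewrite /f /linear_system !mulmx0 addr0 !bform0r !sqn0 !add0r subr0.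
  by rewrite mulr0 addr0.
move: EZ Z0 WZ; rewrite -[Z]vsubmxK -[usubmx Z]vsubmxK.
set Z1 := usubmx (usubmx Z); set Z2 := dsubmx (usubmx Z); set V := dsubmx Z.
rewrite !mul_row_col !mul1mx !mul0mx !addr0 !mul_block_col !mul0mx !addr0 !add0r.
move=> EZ Z0 WZ.
have [QZ1 PZ2] : Q *m Z1 = 0 /\ P *m Z2 = 0.
  have [+ _] := eq_col_mx (etrans WZ (esym (@col_mx0 _ _ _ _))).
  by rewrite -(@col_mx0 R n m k) => /eq_col_mx.
move: EZ Z0; rewrite (posdef_ker PP PZ2) mulmx0 addr0 => EZ Z0.
have {}Z0 : Z1 != 0.
  apply: contra Z0 => /eqP Z10; move: EZ; rewrite Z10 mulmx0 !mul0mx add0r => VV.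
  have -> : V = 0 by apply: sqn_eq0; rewrite /sqn VV mxtrace0.
  by rewrite !col_mx0.
have [lam [alpha [lb Ka di]]] := dissipative_at_optimal nrmP diss opt.
exfalso; apply: (@no_persistent_trajectory _ _ _ _ nrmP Y A B Q P s v QP.1 PP.1
  e u lam alpha _ Z1 (sqn Z1)) => //.
- exact: opt.1.2.
- exact: sqn_gt0.
- by move=> t; exact: (sqn_iter_ge t EZ).
- by move=> t; exact: (iter_mul_range t EZ).
- by move=> t j; rewrite YT.
Qed.

End Certificates.

(** * From a quadratic storage function to strict dissipativity *)

Section Sufficiency.
Variables (R : realType) (n m : nat) (nrm : 'cV[R]_n -> R).
Hypothesis nrmP : is_norm nrm.
Variables (A : 'M[R]_n) (B : 'M[R]_(n, m)) (Y : set ('cV[R]_n * 'cV[R]_m)).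
Variables (Q : 'M[R]_n) (P : 'M[R]_m) (s : 'cV[R]_n) (v : 'cV[R]_m).
Hypotheses (symQ : Q^T = Q) (symP : P^T = P).
Variables (e : 'cV[R]_n) (u : 'cV[R]_m) (r : R).
Let f := linear_system A B.
Let l := quadratic_cost Q P s v.
Hypotheses (opt : optimal_equilibrium Y f l e u).
Hypotheses (r0 : 0 < r) (rY : contains_ball Y e u r).

Let gx := 2 *: (Q *m e) + s.
Let gu := 2 *: (P *m u) + v.

Lemma linear_systemD x x' w w' : f (x + x') (w + w') = f x w + f x' w'.
Proof. by rewrite /f /linear_system !mulmxDr addrACA. Qed.

(** A direction [(z, w)] tangent to the equilibria can be followed both ways inside
    [Y], so the first order variation of the cost along it vanishes. *)
Lemma stationary_on_equilibria z w : z = f z w ->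
  bform 1%:M gx z + bform 1%:M gu w = 0.
Proof.
move=> zw; set b := _ + _; apply/eqP/negPn/negP => bN0.
pose S := sqn z + sqn w; pose q := qform Q z + qform P w.
have S0 : 0 <= S by rewrite addr_ge0 ?sqn_ge0.
have b2 : 0 < b ^+ 2 by rewrite exprn_even_gt0.
pose K := 1 + `|q| + b ^+ 2 * S / r.
(* With b the first order variation, the step t = - b * tau changes the cost by
   b ^+ 2 * tau * (tau * q - 1); K makes the step small enough to stay in the
   ball and to have tau * q < 1. *)
have bS : 0 <= b ^+ 2 * S / r.
  by apply: divr_ge0; [exact: mulr_ge0 (ltW b2) S0|exact: ltW].
have K1 : 1 <= K by rewrite /K -addrA lerDl addr_ge0.
pose tau := (2 * K)^-1; pose t := - (b * tau).
have tau0 : 0 < tau by rewrite invr_gt0; lra.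
have tauK : tau * K = 2^-1 by rewrite /tau invfM mulfVK // gt_eqF //; lra.
have tr : t ^+ 2 * S < r.
  have h : b ^+ 2 * S <= r * K.
    by rewrite [leRHS]mulrC -ler_pdivrMr // /K lerDr addr_ge0.
  have -> : t ^+ 2 * S = tau ^+ 2 * (b ^+ 2 * S) by rewrite /t; ring.
  rewrite (@le_lt_trans _ _ (tau ^+ 2 * (r * K))) // ?ler_wpM2l ?sqr_ge0 //.
  have -> : tau ^+ 2 * (r * K) = r * (tau * (tau * K)) by ring.
  rewrite tauK gtr_pMr //.
  have : tau <= tau * K by rewrite ler_peMr // ltW.
  by rewrite tauK; lra.
have tz : sqn (t *: z) < r.
  rewrite sqnZ (le_lt_trans _ tr) // ler_wpM2l ?sqr_ge0 // lerDl; exact: sqn_ge0.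
have tw : sqn (t *: w) < r.
  rewrite sqnZ (le_lt_trans _ tr) // ler_wpM2l ?sqr_ge0 // lerDr; exact: sqn_ge0.
have eqt : equilibrium Y f (e + t *: z) (u + t *: w).
  split; first exact: rY.
  rewrite linear_systemD -opt.1.2; congr (_ + _).
  by rewrite /f /linear_system -!scalemxAr -scalerDr -/(linear_system A B z w) -/f -zw.
have := opt.2 _ _ eqt; rewrite /l quadratic_cost_taylor // -/gx -/gu.
rewrite !(bformZl, bformZr) -addrA lerDl.
have -> : t * (t * qform Q z) + t * (t * qform P w) +
    (t * bform 1%:M gx z + t * bform 1%:M gu w) = b ^+ 2 * tau * (tau * q - 1).
  by rewrite /t /q /b; ring.
rewrite (pmulr_rge0 _ (mulr_gt0 b2 tau0)) subr_ge0 => h.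
have : tau * q <= tau * K.
  rewrite ler_pM2l // /K; have := ler_norm q; lra.
by rewrite tauK; lra.
Qed.

(** The gradient of the cost at an interior optimal equilibrium vanishes on the
    kernel of the equilibrium equation, hence lies in its row space. *)
Lemma equilibrium_multiplier : exists p : 'cV[R]_n, forall z w,
  bform 1%:M gx z + bform 1%:M gu w = bform 1%:M p (z - f z w).
Proof.
pose C := row_mx (1%:M - A) (- B); pose g := row_mx gx^T gu^T.
have gE z w : bform 1%:M gx z + bform 1%:M gu w = (g *m col_mx z w) 0 0.
  by rewrite mul_row_col mxE /bform !mulmx1.
have CE z w : C *m col_mx z w = z - f z w.
  by rewrite mul_row_col mulmxBl mul1mx mulNmx /f /linear_system opprD addrA.
have /submxP[D gD] : (g <= C)%MS.
  rewrite submxE; apply/eqP/matrixP => i j; rewrite ord1 [RHS]mxE.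
  set y := col j (cokermx C).
  have y0 : C *m y = 0 by rewrite /y colE mulmxA mulmx_coker mul0mx.
  have colg (X : 'M[R]_(n + m)) : (g *m X) 0 j = (g *m col j X) 0 0.
    by rewrite colE mulmxA -colE [RHS]mxE.
  rewrite colg -/y.
  rewrite -[y]vsubmxK -gE; apply: stationary_on_equilibria.
  by apply/subr0_eq; rewrite -CE vsubmxK.
exists D^T => z w; rewrite gE gD -mulmxA CE.
by rewrite /bform mulmx1 trmxK.
Qed.

Lemma class_Kinf_sqr (a : R) : 0 < a -> class_Kinf (fun t : R => a * t ^+ 2).
Proof.
move=> a0; split.
- apply: continuous_subspaceT; apply: continuous_mulr; first exact: cst_continuous.
  by move=> x; exact: exprn_continuous.
- by move=> t _; rewrite mulr_ge0 ?sqr_ge0 // ltW.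
- by move=> x t x0 xt; rewrite ltr_pM2l // ltr_sqr ?nnegrE // (le_trans x0) // ltW.
- move=> M; pose t := `|M| / a + 1.
  have t1 : 1 <= t by rewrite lerDr divr_ge0 // ltW.
  exists t; first lra.
  rewrite (@lt_le_trans _ _ (a * t)) //; last first.
    by rewrite ler_pM2l // expr2 ler_peMl //; lra.
  rewrite /t mulrDr mulr1 mulrC mulfVK ?gt_eqF //.
  by rewrite (le_lt_trans (ler_norm M)) // ltrDl.
- by rewrite expr0n mulr0.
Qed.

Lemma continuous_bounded_on_bounded (lam : 'cV[R]_n -> R) :
  continuous lam -> bounded_on_bounded nrm Y lam.
Proof.
move=> lamC S _ [K SK].
have [a a0 nrma] := nrm_sqn_lower nrmP.
have lamN : continuous (fun x => `|lam x|).
  by move=> x; apply: continuous_comp; [exact: lamC|exact: norm_continuous].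
have K0 : 0 <= K ^+ 2 / a by rewrite divr_ge0 ?sqr_ge0 // ltW.
have ne : [set x : 'cV[R]_n | sqn x <= K ^+ 2 / a] !=set0.
  by exists 0; rewrite /= sqn0.
have [x0 _ xmax] :=
  compact_EVT_max ne (@compact_sqn_ball _ _ _) (continuous_subspaceT lamN).
exists `|lam x0| => x Sx; apply/xmax/mem_set => /=.
rewrite ler_pdivlMr // mulrC (le_trans (nrma x)) //.
rewrite ler_sqr ?nnegrE ?(nrm_ge0 nrmP) ?SK //.
by rewrite (le_trans (nrm_ge0 nrmP x)) ?SK.
Qed.

(** The storage is the quadratic one minus the multiplier term: the latter
    compensates the linear part of the cost, and the certificate is then the
    dissipation inequality with a quadratic comparison function.  The second
    hypothesis makes this storage bounded below. *)
Lemma strictly_dissipative_of_certificate (M : 'M[R]_n) c :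
  lyapunov_certificate A B Q P M 1 c ->
  compact Y \/ (exists2 d, 0 < d & forall z, d * sqn z <= qform M z) ->
  strictly_dissipative_at nrm Y f l e u.
Proof.
move=> [_ c0 Mc] below; split; first exact: opt.1.
have [p pE] := equilibrium_multiplier.
have [b b0 nrmb] := nrm_sqn_upper nrmP.
pose lam x := qform M (x - e) + -1 * bform 1%:M p (x - e).
have lamC : continuous lam.
  have xe i : continuous (fun x : 'cV[R]_n => (x - e) i 0).
    rewrite (_ : (fun x : 'cV[R]_n => _) = fun x => x i 0 + - e i 0).
      by apply: continuous_addr; [exact: coord_continuous|exact: cst_continuous].
    by apply/funext => x; rewrite !mxE.
  apply: continuous_addr; first exact: bform_continuous.
  apply: continuous_mulr; first exact: cst_continuous.
  by apply: bform_continuous => // i; exact: cst_continuous.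
exists lam, (fun t => c / b * t ^+ 2); split.
- exact: continuous_bounded_on_bounded.
- case: below => [cY|[d d0 Md]].
    have fstC : continuous (fun y : 'cV[R]_n * 'cV[R]_m => lam y.1).
      by move=> y; apply: continuous_comp; [exact: cvg_fst|exact: lamC].
    have [y _ ymin] :=
      compact_EVT_min (ex_intro _ _ opt.1.1) cY (continuous_subspaceT fstC).
    by exists (lam y.1) => x [w Yx]; apply: (ymin (x, w)); exact: mem_set.
  exists (- (sqn p / (4 * d))) => x _; rewrite /lam; set z := x - e.
  (* Completing the square in d * sqn z - bform 1 p z. *)
  have h : 0 <= d * sqn (1 *: z + (- (2 * d)^-1) *: p).
    by rewrite mulr_ge0 ?sqn_ge0 // ltW.
  have pz : bform 1%:M p z = \tr (z^T *m p).
    by rewrite mxtr_dotC /bform mulmx1 trace_mx11.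
  have := Md z; move: h; rewrite sqn_comb -pz.
  have -> : d * (1 ^+ 2 * sqn z + 2 * (1 * - (2 * d)^-1) * bform 1%:M p z +
      (- (2 * d)^-1) ^+ 2 * sqn p) = d * sqn z - bform 1%:M p z + sqn p / (4 * d).
    by field; rewrite gt_eqF.
  lra.
- by apply: class_Kinf_sqr; rewrite divr_gt0.
- move=> x w Yx _; pose z := x - e; pose w' := w - u.
  have xE : x = e + z by rewrite addrC subrK.
  have wE : w = u + w' by rewrite addrC subrK.
  have fE : f x w - e = f z w'.
    by rewrite xE wE linear_systemD -opt.1.2 addrC addKr.
  rewrite /lam fE -/z.
  have -> : l x w - l e u = qform Q z + qform P w' + bform 1%:M p (z - f z w').
    by rewrite xE wE /l quadratic_cost_taylor // -/gx -/gu pE; ring.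
  rewrite -scaleN1r bformDr bformZr.
  have h1 : c / b * nrm z ^+ 2 <= c * sqn z.
    by rewrite -mulrA ler_pM2l // mulrC ler_pdivrMr // mulrC.
  have := Mc z w'; rewrite -/f; lra.
Qed.

End Sufficiency.

(** * Convex combinations of two costs *)

Section Weighting.
Variables (R : realType) (n m : nat).
Variables (A : 'M[R]_n) (B : 'M[R]_(n, m)).

Lemma lyapunov_certificate_weight (Q Q' M : 'M[R]_n) (P P' : 'M[R]_m) (k c nu : R) :
  lyapunov_certificate A B Q P M k c -> 0 < nu ->
  (forall z w, nu * (qform Q z + qform P w) <= qform Q' z + qform P' w) ->
  lyapunov_certificate A B Q' P' (nu / k *: M) 1 (nu / k * c).
Proof.
move=> [k0 c0 Mc] nu0 QQ; have nk : 0 < nu / k by rewrite divr_gt0.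
split=> // [|z w]; first by rewrite mulr_gt0.
rewrite !bformMZ mul1r -mulrA -mulrBr.
have h : nu / k * (c * sqn z) <= nu / k * (qform M z - qform M (linear_system A B z w)
    + k * (qform Q z + qform P w)) by rewrite ler_pM2l // Mc.
rewrite (le_trans h) // mulrDr lerD2l mulrA mulfVK ?gt_eqF //.
Qed.

Lemma weighted_quadratic_cost (Q1 Q2 : 'M[R]_n) (P1 P2 : 'M[R]_m) s1 s2 v1 v2 mu :
  weighted_cost (quadratic_cost Q1 P1 s1 v1) (quadratic_cost Q2 P2 s2 v2) mu =
  quadratic_cost (mu *: Q1 + (1 - mu) *: Q2) (mu *: P1 + (1 - mu) *: P2)
    (mu *: s1 + (1 - mu) *: s2) (mu *: v1 + (1 - mu) *: v2).
Proof.
apply/funext => x; apply/funext => u.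
rewrite /weighted_cost !quadratic_cost_bform !bformMD !bformMZ !bformDl !bformZl; ring.
Qed.

End Weighting.

Theorem theorem3p1 (R : realType) (n m : nat)
    (nrm : 'cV[R]_n -> R) (nrmP : is_norm nrm)
    (A : 'M[R]_n) (B : 'M[R]_(n, m))
    (Y : set ('cV[R]_n * 'cV[R]_m)) (Y0 : Y !=set0)
    (Q1 Q2 : 'M[R]_n) (R1 R2 : 'M[R]_m)
    (s1 s2 : 'cV[R]_n) (v1 v2 : 'cV[R]_m)
    (Q1P : possemidef_sym Q1) (Q2P : possemidef_sym Q2)
    (R1P : posdef_sym R1) (R2P : posdef_sym R2)
    (f := linear_system A B)
    (l1 := quadratic_cost Q1 R1 s1 v1)
    (l2 := quadratic_cost Q2 R2 s2 v2)
    (YP : (@convex_set R ('cV[R]_n * 'cV[R]_m)%type Y /\ compact Y)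
          \/ Y = setT)
    (diss1 : strictly_dissipative nrm Y f l1)
    (diss2 : strictly_dissipative nrm Y f l2)
    (xe : R -> 'cV[R]_n) (ue : R -> 'cV[R]_m)
    (opt : forall mu : R, 0 <= mu <= 1 ->
       optimal_equilibrium Y f (weighted_cost l1 l2 mu) (xe mu) (ue mu))
    (inner : compact Y -> forall mu : R, 0 <= mu <= 1 -> Y° (xe mu, ue mu)) :
  forall mu : R, 0 <= mu <= 1 ->
    strictly_dissipative_at nrm Y f (weighted_cost l1 l2 mu) (xe mu) (ue mu).
Proof.
have ball mu : 0 <= mu <= 1 -> exists2 r, 0 < r & contains_ball Y (xe mu) (ue mu) r.
  move=> mu01; case: YP => [[_ cY]|YT]; first exact/interior_ball/inner.
  by exists 1 => // z w _ _; rewrite YT.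
have certificate Q P s v x u (QP : possemidef_sym Q) (PP : posdef_sym P)
    (d : strictly_dissipative nrm Y f (quadratic_cost Q P s v))
    (o : optimal_equilibrium Y f (quadratic_cost Q P s v) x u)
    (b : exists2 r, 0 < r & contains_ball Y x u r) :
    exists M k c, lyapunov_certificate A B Q P M k c /\
      (compact Y \/ forall z, c * sqn z <= qform M z).
  case: YP => [[_ cY]|YT].
    have [r r0 rY] := b.
    have [M [k [c Mc]]] := lyapunov_of_dissipative_ball nrmP QP PP d o r0 rY.
    by exists M, k, c; split=> //; left.
  have [M [k [c [Mc Mpos]]]] := lyapunov_of_dissipative_full nrmP QP PP d o YT.
  by exists M, k, c; split=> //; right.
have l1E : weighted_cost l1 l2 1 = l1.
  apply/funext => x; apply/funext => u.
  by rewrite /weighted_cost mul1r subrr mul0r addr0.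
have l2E : weighted_cost l1 l2 0 = l2.
  apply/funext => x; apply/funext => u.
  by rewrite /weighted_cost subr0 mul0r mul1r add0r.
have i01 : 0 <= (0 : R) <= 1 by rewrite lexx ler01.
have i11 : 0 <= (1 : R) <= 1 by rewrite ler01 lexx.
have := opt _ i11; rewrite l1E => o1; have := opt _ i01; rewrite l2E => o2.
move=> mu mu01; have /andP[mu0 mu1] := mu01.
have omu := opt _ mu01; have [r r0 rY] := ball _ mu01.
rewrite weighted_quadratic_cost in omu *.
set Q := _ + _ in omu *; set P := (X in quadratic_cost _ X) in omu *.
have symQ : Q^T = Q by rewrite /Q linearD /= !linearZ /= Q1P.1 Q2P.1.
have symP : P^T = P by rewrite /P linearD /= !linearZ /= R1P.1 R2P.1.
have QPE z w : qform Q z + qform P w =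
    mu * (qform Q1 z + qform R1 w) + (1 - mu) * (qform Q2 z + qform R2 w).
  by rewrite /Q /P !bformMD !bformMZ; ring.
have nonneg Qi Pi z w : possemidef_sym Qi -> posdef_sym Pi ->
    0 <= qform Qi z + qform Pi w.
  by move=> QiP PiP; rewrite addr_ge0 ?psd_ge0 //; exact: posdef_psd.
(* A certificate of one of the two costs with positive weight nu is enough, because
   the quadratic part of the other one is nonnegative. *)
suff [Qi [Pi [M [k [c [nu [nu0 [Mc below] nuQ]]]]]]] :
    exists Qi Pi M k c nu, [/\ 0 < nu,
      lyapunov_certificate A B Qi Pi M k c /\
      (compact Y \/ forall z, c * sqn z <= qform M z)
      & forall z w, nu * (qform Qi z + qform Pi w) <= qform Q z + qform P w].
  have [k0 c0 _] := Mc; have nk : 0 < nu / k by rewrite divr_gt0.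
  apply: (strictly_dissipative_of_certificate nrmP symQ symP omu r0 rY
    (lyapunov_certificate_weight Mc nu0 nuQ)).
  case: below => [|Mpos]; [by left|right; exists (nu / k * c); first exact: mulr_gt0].
  by move=> z; rewrite bformMZ -mulrA ler_pM2l.
move: mu0; rewrite le_eqVlt => /orP[/eqP mu00|mu0].
  have [M [k [c Mc]]] := certificate _ _ _ _ _ _ Q2P R2P diss2 o2 (ball _ i01).
  exists Q2, R2, M, k, c, 1; split=> // z w.
  by rewrite QPE -mu00 mul0r add0r subr0.
have [M [k [c Mc]]] := certificate _ _ _ _ _ _ Q1P R1P diss1 o1 (ball _ i11).
exists Q1, R1, M, k, c, mu; split=> // z w.
by rewrite QPE lerDl mulr_ge0 ?subr_ge0 // nonneg.
Qed.
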